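(* Let $\mathcal L=\{Y_n\}=\{(X_n,J_n)\}$ be a $d$-dimensional skip-free semi-irreducible MMRRW each of whose induced Markov chains $\mathcal L^A$ ($\emptyset\ne A\subset D$) is either semi-irreducible and stable, or transient. If there exists a positive vector $w\in\mathbb R^d$ such that $\langle a^A,w\rangle<0$ for all $A\in\mathcal D_{stable}$, then $\mathcal L$ is stable.
   Context: Notation: $D=\{1,\dots,d\}$; $\mathcal P(A)$ is the set of all subsets of $A$ (including $\emptyset$); for $x\in\mathbb R^d$, $x(l)$ is the $l$-th coordinate and $x(A)=(x(l))_{l\in A}$; relations between a vector and a number, such as $x(A)>0$, hold coordinatewise (vacuously if $A=\emptyset$); $\langle\cdot,\cdot\rangle$ is the Euclidean inner product. For $A\in\mathcal P(D)$ let $\mathcal B^A=\{x\in\mathbb R_+^d: x(A)>0,\ x(D\setminus A)=0\}$ and let $S^A=\{1,\dots,s^A\}$ be a nonempty finite set. MMRRW. A $d$-dimensional skip-free Markov modulated reflecting random walk (MMRRW) $\mathcal L=\{Y_n\}=\{(X_n,J_n)\}$ is a discrete-time homogeneous Markov chain on $\mathcal S=\bigcup_{A\in\mathcal P(D)}(\mathcal B^A\cap\mathbb Z^d)\times S^A$ such that $X_{n+1}-X_n\in\{-1,0,1\}^d$ and, whenever $x\in\mathcal B^A\cap\mathbb Z^d$, $z\in\{-1,0,1\}^d$, $x+z\in\mathcal B^B\cap\mathbb Z^d$, $i\in S^A$, $j\in S^B$, the probability $\mathbb P(Y_{n+1}=(x+z,j)\mid Y_n=(x,i))=p_z^{A,B}(i,j)$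 depends only on $A,B,z,i,j$. Semi-irreducibility and stability (for any countable-state Markov chain). The chain is semi-irreducible if it has exactly one irreducible (closed communicating) class $\mathcal S_0$ and every state of $\mathcal S_0$ is accessible from every state. A semi-irreducible chain is stable if $\mathcal S_0$ is positive recurrent and from every state outside $\mathcal S_0$ the first passage time to $\mathcal S_0$ is a.s. finite with finite expectation. It is unstable if either $\mathcal S_0$ is transient, or there is a state outside $\mathcal S_0$ from which, with positive probability, $\mathcal S_0$ is never reached. Expanded and induced chains. Let $\emptyset\ne A\in\mathcal P(D)$. For $B\in\mathcal P(D\setminus A)$ let $\hat{\mathcal B}^{A,B}=\{x\in\mathbb R^d: x(B)>0,\ x(D\setminus(A\cup B))=0\}$ ($x(A)$ arbitrary). The expanded chain $\hat{\mathcal L}^A=\{Y^A_n\}=\{(X^A_n,J^A_n)\}$ is the Markov chain on $\hat{\mathcal S}^A=\bigcup_{B\in\mathcal P(D\setminus A)}(\hat{\mathcal B}^{A,B}\cap\mathbb Z^d)\times S^{A\cup B}$ with $\mathbb P(Y^A_{n+1}=(x+z,j)\mid Y^A_n=(x,i))=p_z^{A\cup B,A\cup C}(i,j)$ for $x\in\hat{\mathcal B}^{A,B}\cap\mathbb Z^d$, $z\in\{-1,0,1\}^d$, $x+z\in\hat{\mathcal B}^{A,C}\cap\mathbb Z^d$, $i\in S^{A\cup B}$, $j\in S^{A\cup C}$. The process $\mathcal L^A=\{(X^A_n(D\setminus A),J^A_n)\}$ is itself a Markov chain (a $(d-|A|)$-dimensional MMRRW; a finite chain if $A=D$), called the induced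 Markov chain with index $A$. ''$\mathcal L^A$ is transient'' means that all its states are transient (semi-irreducibility not required). $\mathcal D_{stable}$ is the set of nonempty $A\in\mathcal P(D)$ such that $\mathcal L^A$ is semi-irreducible and stable (always $D\in\mathcal D_{stable}$). For $A\in\mathcal D_{stable}$ the mean drift vector is $a^A=\lim_{n\to\infty}\frac1n(X^A_n-X^A_0)\in\mathbb R^d$ (a.s. limit, nonrandom); equivalently, it is the expectation of the one-step conditional mean increment vector of $X^A$ under the stationary distribution of $\mathcal L^A$. One has $a^A(D\setminus A)=0$. *)

(* Defs.v *)
From mathcomp Require Import all_boot all_order all_algebra.
From mathcomp Require Import all_classical all_reals all_analysis.

Set Implicit Arguments.
Unset Strict Implicit.
Unset Printing Implicit Defensive.

Import Order.TTheory GRing.Theory Num.Theory.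
Import numFieldNormedType.Exports.

Local Open Scope classical_set_scope.
Local Open Scope ring_scope.
Local Open Scope ereal_scope.

Section CountableChains.
Variables (R : realType) (T : countType).

(* A homogeneous Markov chain given by its transition probabilities; the state
   space is a subset of an ambient countable type, and the values of
   [trans] outside [states] are irrelevant. *)
Record chain := Chain { states : set T; trans : T -> T -> \bar R }.

Implicit Types (K : chain) (B C : set T).

Definition is_stochastic K :=
  (forall x y, states K x -> states K y -> 0 <= trans K x y) /\
  (forall x, states K x -> \esum_(y in states K) trans K x y = 1).

Fixpoint nstep K n x y : \bar R :=
  if n is m.+1 then \esum_(z in states K) (trans K x z * nstep K m z y)
  else (x == y)%:R%:E.

Definition accessible K x y := exists n, 0 < nstep K n x y.

Definition irreducible_class K C :=
  [/\ C `<=` states K, C !=set0,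
      forall x y, C x -> C y -> accessible K x y &
      forall x y, C x -> states K y -> accessible K x y -> C y].

Definition is_S0 K C :=
  [/\ irreducible_class K C,
      forall C', irreducible_class K C' -> C' = C &
      forall x y, states K x -> C y -> accessible K x y].

Definition semi_irreducible K := exists C, is_S0 K C.

(* P_x(tau_B = n + 1), where tau_B = inf {n >= 1 : Y_n \in B}; the first
   passage time to B when x lies outside B, the first return time when x
   lies in B. *)
Fixpoint passage_at K B n x : \bar R :=
  if n is m.+1 then
    \esum_(y in states K `\` B) (trans K x y * passage_at K B m y)
  else \esum_(y in B) trans K x y.

(* P_x(tau_B < oo) *)
Definition passage_prob K B x := \sum_(0 <= n <oo) passage_at K B n x.

(* E_x[tau_B ; tau_B < oo] *)
Definition passage_mean K B x :=
  \sum_(0 <= n <oo) (n.+1%:R%:E * passage_at K B n x).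

Definition passage_integrable K B x :=
  passage_prob K B x = 1 /\ passage_mean K B x < +oo.

Definition positive_recurrent K C :=
  forall x, C x -> passage_integrable K [set x] x.

Definition stable K := exists C,
  [/\ is_S0 K C, positive_recurrent K C &
      forall x, states K x -> ~ C x -> passage_integrable K C x].

Definition transient K :=
  forall x, states K x -> passage_prob K [set x] x < 1.

(* The process Y on the probability space (Omega, P) is a Markov chain with the
   states and transition probabilities of K, started at x0. As T is countable,
   Y n is measurable iff its fibres are. *)
Definition is_realization (disp : measure_display)
    (Omega : measurableType disp) (P : probability Omega R)
    K (x0 : T) (Y : nat -> Omega -> T) :=
  [/\ forall n y, measurable (Y n @^-1` [set y]),
      forall n omega, states K (Y n omega),
      forall omega, Y 0%N omega = x0 &
      forall n (y : nat -> T), (forall k, states K (y k)) ->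
        P [set omega | forall k, (k <= n.+1)%N -> Y k omega = y k] =
        P [set omega | forall k, (k <= n)%N -> Y k omega = y k]
          * trans K (y n) (y n.+1)].

End CountableChains.

Section MMRRW.
Variables (R : realType) (d : nat).

(* D is 'I_d. The set S^A is represented by {0, ..., nmodes A - 1}, and
   prob A B z i j is p_z^{A,B}(i,j). *)
Record mmrrw_data := MMRRWData {
  nmodes : {set 'I_d} -> nat;
  prob : {set 'I_d} -> {set 'I_d} -> 'rV[int]_d -> nat -> nat -> R }.

Implicit Types (L : mmrrw_data) (A : {set 'I_d}) (x z : 'rV[int]_d).

Definition state : countType := ('rV[int]_d * nat)%type.

Implicit Types y : state.

Definition skip_free z := [forall l, z ord0 l \in [:: -1; 0; 1]%R].

(* For x >= 0, the unique A such that x lies in \mathcal B^A. *)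
Definition positive_coords x : {set 'I_d} := [set l | (0 < x ord0 l)%R]%SET.

Definition mmrrw_chain L : chain R state := Chain
  [set y : state | (forall l, (0 <= y.1 ord0 l)%R) /\
                   (y.2 < nmodes L (positive_coords y.1))%N]
  (fun y y' => if skip_free (y'.1 - y.1)%R then
     (prob L (positive_coords y.1) (positive_coords y'.1)
             (y'.1 - y.1)%R y.2 y'.2)%:E
   else 0).

Definition is_mmrrw L := (forall A, 0 < nmodes L A)%N /\ is_stochastic (mmrrw_chain L).

(* A :|: B, where B is the subset of D \ A such that x lies in
   \hat{\mathcal B}^{A,B}. *)
Definition face A x : {set 'I_d} := (A :|: positive_coords x)%SET.

Definition expanded_chain L A : chain R state := Chain
  [set y : state | (forall l, l \notin A -> (0 <= y.1 ord0 l)%R) /\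
                   (y.2 < nmodes L (face A y.1))%N]
  (fun y y' => if skip_free (y'.1 - y.1)%R then
     (prob L (face A y.1) (face A y'.1) (y'.1 - y.1)%R y.2 y'.2)%:E
   else 0).

(* (x, j) |-> (x(D \ A), j), where x(D \ A) is represented by the vector of
   Z^d obtained by setting the coordinates in A to zero. *)
Definition forget A y : state :=
  (\row_l (if l \in A then 0%R else y.1 ord0 l), y.2).

(* The image of the expanded chain by [forget]. Since the transition
   probabilities of the expanded chain are invariant under translation of the
   coordinates in A, the image is Markov and its transition probabilities may
   be computed from the representative y with y.1(A) = 0. *)
Definition induced_chain L A : chain R state := Chain
  (forget A @` states (expanded_chain L A))
  (fun y y' => \esum_(u in states (expanded_chain L A) `&` forget A @^-1` [set y'])
                 trans (expanded_chain L A) y u).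

Definition D_stable L A :=
  [/\ A != finset.set0, semi_irreducible (induced_chain L A) & stable (induced_chain L A)].

(* From every initial state, (X^A_n - X^A_0) / n converges to v almost surely.
   This depends only on the law of the expanded chain, hence not on the
   realization. *)
Definition is_mean_drift L A (v : 'rV[R]_d) :=
  forall y0 : state, states (expanded_chain L A) y0 ->
  exists (disp : measure_display) (Omega : measurableType disp)
         (P : probability Omega R) (Y : nat -> Omega -> state),
    is_realization P (expanded_chain L A) y0 Y /\
    {ae P, forall omega, forall l : 'I_d,
       (((Y n omega).1 ord0 l - (Y 0%N omega).1 ord0 l)%:~R / n%:R : R)%R
         @[n --> \oo] --> v ord0 l}.

(* Meaningful for A in D_stable, where the limit exists and is unique; as with
   [lim], the default value 0 is arbitrary. *)
Definition mean_drift L A : 'rV[R]_d := xget 0%R [set v | is_mean_drift L A v].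

Definition inner (u v : 'rV[R]_d) : R := (\sum_l u ord0 l * v ord0 l)%R.

End MMRRW.

(* Main.v *)
Require Import Defs.
From mathcomp Require Import all_boot all_order all_algebra.
From mathcomp Require Import finmap.
From mathcomp Require Import all_classical all_reals all_analysis.
From mathcomp Require Import ring lra.

Set Implicit Arguments.
Unset Strict Implicit.
Unset Printing Implicit Defensive.

Import Order.TTheory GRing.Theory Num.Theory.
Import numFieldNormedType.Exports.

Local Open Scope ring_scope.

(** The function [level y], the inner product of the position with [w], is a
    Lyapunov function after a long enough deterministic time. By downward
    induction on [A], some time is such that the mean of [level] has decreased
    by at least 1 for the expanded chain with index [A], from every state.
    If a coordinate outside [A] exceeds that time, it may be added to [A].
    This leaves finitely many states up to translation: for stable [A] the mean
    drift decides, and for transient [A] the chain spends a bounded expected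
    time in these states, so that the negative drift elsewhere prevails. For
    [A] empty this yields Foster's criterion with a finite exceptional set.
    The mean drift is never computed: if the limit defining it did not exist,
    [mean_drift] would be 0, contradicting the strict inequality. *)

(** * One-step means and first passages *)

Section StepMean.
Local Open Scope classical_set_scope.
Variables (R : realType) (T : countType).
Implicit Types (K : chain R T) (B D : set T) (g h : T -> R).

Definition succ_states K x : set T := [set y | states K y /\ trans K x y != 0%E].

Definition finite_rows K := forall x, states K x -> finite_set (succ_states K x).

(** Under [finite_rows] this sum runs over the whole support of the row, so unbounded and signed
    functions have real means without integrability conditions. *)
Definition step_mean K g x : R :=
  \sum_(y <- fset_set (succ_states K x)) fine (trans K x y) * g y.

(** Only the arrival is tested against [B], not the starting point, so that iterates started inside
    [B] describe return times. *)
Definition killed_mean K B g : T -> R :=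
  step_mean K (fun y => if y \in B then 0 else g y).

Variable K : chain R T.

Lemma esum_succ_states x (a : T -> \bar R) :
    (forall y, states K y -> trans K x y = 0%E -> a y = 0%E) ->
  (\esum_(y in states K) a y = \esum_(y in succ_states K x) a y)%E.
Proof.
move=> a0.
rewrite (_ : succ_states K x = states K `&` [set y | trans K x y != 0%E])//.
rewrite esum_mkcondr; apply: eq_esum => y Sy.
by case: ifPn => //; rewrite notin_setE/= => /negP; rewrite negbK => /eqP /a0->.
Qed.

Hypotheses (Kstoch : is_stochastic K) (Kfin : finite_rows K).
Local Notation S := (states K).
Local Notation P := (step_mean K).

Lemma trans_le1 x y : S x -> S y -> (trans K x y <= 1)%E.
Proof.
move=> Sx Sy; rewrite -(Kstoch.2 x Sx); apply: esum_ge.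
exists [set y]; first by split; [exact: finite_set1|move=> _ ->].
by rewrite fsbig_set1.
Qed.

Lemma trans_fin x y : S x -> S y -> (trans K x y \is a fin_num)%E.
Proof.
move=> Sx Sy; rewrite ge0_fin_numE ?Kstoch.1//.
exact: le_lt_trans (trans_le1 Sx Sy) (ltry _).
Qed.

Lemma in_succ x y : S x -> (y \in fset_set (succ_states K x)) -> S y.
Proof. by move=> Sx; rewrite in_fset_set; [move=> /set_mem[]|exact: Kfin]. Qed.

Lemma trans_ge0 x y : S x -> S y -> 0 <= fine (trans K x y).
Proof. by move=> Sx Sy; rewrite fine_ge0 ?Kstoch.1. Qed.

Lemma step_mean_esum g x : S x -> (forall y, S y -> 0 <= g y) ->
  (\esum_(y in S) (trans K x y * (g y)%:E) = (P g x)%:E)%E.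
Proof.
move=> Sx g0.
rewrite (@esum_succ_states x) => [|y _ ->]; last by rewrite mul0e.
have fS := Kfin Sx.
rewrite esum_fset//; last first.
  by move=> y /set_mem[Sy _]; rewrite mule_ge0 ?lee_fin ?g0// Kstoch.1.
rewrite fsbig_finite//= /step_mean -sumEFin big_seq [RHS]big_seq.
apply: eq_bigr => y ys; rewrite EFinM fineK// trans_fin//.
exact: in_succ ys.
Qed.

Lemma step_mean_esum_sub D g x : S x -> D `<=` S -> (forall y, D y -> 0 <= g y) ->
  (\esum_(y in D) (trans K x y * (g y)%:E) =
   (P (fun y => if y \in D then g y else 0) x)%:E)%E.
Proof.
move=> Sx DS g0; rewrite -step_mean_esum//; last first.
  by move=> y Sy; case: ifPn => // /[!inE] /g0.
have -> : D = S `&` D by rewrite setIidr.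
rewrite esum_mkcondr; apply: eq_esum => y Sy.
rewrite (_ : (y \in S `&` D) = (y \in D)) ?setIidr//.
by case: ifPn => // _; rewrite mule0.
Qed.

Lemma eq_step_mean g h x : S x -> (forall y, S y -> g y = h y) -> P g x = P h x.
Proof.
move=> Sx gh; rewrite /step_mean big_seq [RHS]big_seq; apply: eq_bigr => y ys.
by rewrite gh//; exact: in_succ ys.
Qed.

Lemma le_step_mean g h x : S x -> (forall y, S y -> g y <= h y) -> P g x <= P h x.
Proof.
move=> Sx gh; rewrite /step_mean big_seq [leRHS]big_seq; apply: ler_sum => y ys.
have Sy := in_succ Sx ys.
by rewrite ler_wpM2l ?gh// trans_ge0.
Qed.

Lemma step_meanD g h x : P (fun y => g y + h y) x = P g x + P h x.
Proof. by rewrite -big_split; apply: eq_bigr => y _; rewrite mulrDr. Qed.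

Lemma step_meanZ c g x : P (fun y => c * g y) x = c * P g x.
Proof. by rewrite mulr_sumr; apply: eq_bigr => y _; rewrite mulrCA. Qed.

Lemma step_meanB g h x : P (fun y => g y - h y) x = P g x - P h x.
Proof.
rewrite -sumrB; apply: eq_bigr => y _; by rewrite mulrBr.
Qed.

Lemma step_mean_sum (I : Type) (r : seq I) (G : I -> T -> R) x :
  P (fun y => \sum_(i <- r) G i y) x = \sum_(i <- r) P (G i) x.
Proof.
rewrite exchange_big/=; apply: eq_bigr => y _; by rewrite mulr_sumr.
Qed.

Lemma step_mean_cst c x : S x -> P (fun=> c) x = c.
Proof.
move=> Sx; have : P (fun=> 1) x = 1.
  apply: EFin_inj; rewrite -step_mean_esum// -[RHS](Kstoch.2 x Sx).
  by apply: eq_esum => y _; rewrite mule1.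
move=> P1; rewrite -[RHS]mulr1 -P1 -step_meanZ.
by congr (P _ x); apply/funext => y; rewrite mulr1.
Qed.

Lemma step_mean_ge0 g x : S x -> (forall y, S y -> 0 <= g y) -> 0 <= P g x.
Proof.
by move=> Sx g0; apply: le_trans (le_step_mean Sx g0); rewrite step_mean_cst.
Qed.

Lemma eq_iter_step_mean n g h x : S x -> (forall y, S y -> g y = h y) ->
  iter n P g x = iter n P h x.
Proof.
elim: n x => [|n IH] x Sx gh/=; first exact: gh.
by apply: eq_step_mean => // y Sy; exact: IH.
Qed.

Lemma le_iter_step_mean n g h x : S x -> (forall y, S y -> g y <= h y) ->
  iter n P g x <= iter n P h x.
Proof.
elim: n x => [|n IH] x Sx gh/=; first exact: gh.
by apply: le_step_mean => // y Sy; exact: IH.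
Qed.

Lemma iter_step_mean_cst n c x : S x -> iter n P (fun=> c) x = c.
Proof.
elim: n x => [//|n IH] x Sx /=; rewrite (@eq_step_mean _ (fun=> c))//.
exact: step_mean_cst.
Qed.

Lemma iter_step_meanD n g h x : S x ->
  iter n P (fun y => g y + h y) x = iter n P g x + iter n P h x.
Proof.
elim: n x => [//|n IH] x Sx /=; rewrite -step_meanD.
by apply: eq_step_mean => // y Sy; rewrite IH.
Qed.

Lemma iter_step_meanDc n g c x : S x ->
  iter n P (fun y => g y + c) x = iter n P g x + c.
Proof. by move=> Sx; rewrite iter_step_meanD// iter_step_mean_cst. Qed.

Lemma iter_step_meanZ n c g x : S x ->
  iter n P (fun y => c * g y) x = c * iter n P g x.
Proof.
elim: n x => [//|n IH] x Sx /=; rewrite -step_meanZ.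
by apply: eq_step_mean => // y Sy; rewrite IH.
Qed.

Lemma iter_step_mean_sum n (I : Type) (r : seq I) (G : I -> T -> R) x : S x ->
  iter n P (fun y => \sum_(i <- r) G i y) x = \sum_(i <- r) iter n P (G i) x.
Proof.
elim: n x => [//|n IH] x Sx /=; rewrite -step_mean_sum.
by apply: eq_step_mean => // y Sy; rewrite IH.
Qed.

Lemma iter_step_mean_growth n g c x : (forall y, S y -> P g y <= g y + c) ->
  S x -> iter n P g x <= g x + c * n%:R.
Proof.
move=> Pg; elim: n x => [|n IH] x Sx /=; first by rewrite mulr0 addr0.
apply: (le_trans (le_step_mean Sx IH)); rewrite step_meanD step_mean_cst//.
by have := Pg _ Sx; rewrite -natr1; lra.
Qed.

Lemma iter_step_mean_ge0 n g x : S x -> (forall y, S y -> 0 <= g y) ->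
  0 <= iter n P g x.
Proof.
by move=> Sx g0; rewrite -(iter_step_mean_cst n 0 Sx); exact: le_iter_step_mean.
Qed.

Lemma nstepE n x z : S x ->
  (nstep K n x z = (iter n P (fun y => (y == z)%:R) x)%:E)%E.
Proof.
elim: n x => [//|n IH] x Sx /=.
rewrite -step_mean_esum//; first by apply: eq_esum => y Sy; rewrite IH.
move=> y Sy; exact: iter_step_mean_ge0.
Qed.

(** * The chain killed on entering a set *)

Section Killed.
Variable B : set T.
Local Notation Q := (killed_mean K B).

Lemma le_killed_mean g h x : S x -> (forall y, S y -> g y <= h y) -> Q g x <= Q h x.
Proof.
by move=> Sx gh; apply: le_step_mean => // y Sy; case: ifP => // _; exact: gh.
Qed.

Lemma eq_killed_mean g h x : S x -> (forall y, S y -> g y = h y) -> Q g x = Q h x.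
Proof.
by move=> Sx gh; apply: eq_step_mean => // y Sy; case: ifP => // _; exact: gh.
Qed.

Lemma killed_meanD g h x : Q (fun y => g y + h y) x = Q g x + Q h x.
Proof.
rewrite /killed_mean -step_meanD; congr (P _ x); apply/funext => y.
by case: ifP => // _; rewrite addr0.
Qed.

Lemma killed_meanB g h x : Q (fun y => g y - h y) x = Q g x - Q h x.
Proof.
rewrite /killed_mean -step_meanB; congr (P _ x); apply/funext => y.
by case: ifP => // _; rewrite subr0.
Qed.

Lemma killed_meanZ c g x : Q (fun y => c * g y) x = c * Q g x.
Proof.
rewrite /killed_mean -step_meanZ; congr (P _ x); apply/funext => y.
by case: ifP => // _; rewrite mulr0.
Qed.

Lemma killed_mean_sum (I : Type) (r : seq I) (G : I -> T -> R) x :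
  Q (fun y => \sum_(i <- r) G i y) x = \sum_(i <- r) Q (G i) x.
Proof.
rewrite /killed_mean -step_mean_sum; congr (P _ x); apply/funext => y.
by case: ifP => // _; rewrite big1.
Qed.

Lemma killed_mean_ge0 g x : S x -> (forall y, S y -> 0 <= g y) -> 0 <= Q g x.
Proof.
by move=> Sx g0; apply: step_mean_ge0 => // y Sy; case: ifP => // _; exact: g0.
Qed.

Lemma killed_mean_le g x : S x -> (forall y, S y -> 0 <= g y) -> Q g x <= P g x.
Proof.
by move=> Sx g0; apply: le_step_mean => // y Sy; case: ifP => // _; exact: g0.
Qed.

Lemma eq_iter_killed_mean n g h x : S x -> (forall y, S y -> g y = h y) ->
  iter n Q g x = iter n Q h x.
Proof.
elim: n x => [|n IH] x Sx gh/=; first exact: gh.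
by apply: eq_killed_mean => // y Sy; exact: IH.
Qed.

Lemma iter_killed_mean_ge0 n g x : S x -> (forall y, S y -> 0 <= g y) ->
  0 <= iter n Q g x.
Proof.
by elim: n x => [|n IH] x Sx g0 /=; [exact: g0|apply: killed_mean_ge0 => // y Sy; exact: IH].
Qed.

Lemma iter_killed_meanB n g h x : S x ->
  iter n Q (fun y => g y - h y) x = iter n Q g x - iter n Q h x.
Proof.
elim: n x => [//|n IH] x Sx /=; rewrite -killed_meanB.
by apply: eq_killed_mean => // y Sy; rewrite IH.
Qed.

(* The probability that the chain started at [x] does not visit [B] at any of
   the times 1, ..., n. *)
Definition avoid n x := iter n Q (fun=> 1) x.

(* The probability that [n.+1] is the first positive time spent in [B]. *)
Definition first_visit n x := iter n Q (P (fun y => (y \in B)%:R)) x.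

Lemma avoidS n x : avoid n.+1 x = Q (avoid n) x. Proof. by []. Qed.

Lemma avoid_ge0 n x : S x -> 0 <= avoid n x.
Proof. by move=> Sx; apply: iter_killed_mean_ge0. Qed.

Lemma avoid_le1 n x : S x -> avoid n x <= 1.
Proof.
elim: n x => [|n IH] x Sx; first exact: lexx.
rewrite avoidS; apply: le_trans (killed_mean_le _ _) _ => //.
  by move=> y; exact: avoid_ge0.
by rewrite -[leRHS](step_mean_cst 1 Sx); exact: le_step_mean.
Qed.

Lemma first_visit_ge0 n x : S x -> 0 <= first_visit n x.
Proof.
move=> Sx; apply: iter_killed_mean_ge0 => // y Sy.
by apply: step_mean_ge0 => // u _; rewrite ler0n.
Qed.

(** As [P 1 = 1], the mean of the indicator of [B] is [1 - Q 1]; then [Q] is applied [n] times. *)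
Lemma first_visitE n x : S x -> first_visit n x = avoid n x - avoid n.+1 x.
Proof.
move=> Sx; rewrite /avoid iterSr -iter_killed_meanB//.
apply: eq_iter_killed_mean => // y Sy.
rewrite -[X in X - _](step_mean_cst 1 Sy) -step_meanB.
apply: eq_step_mean => // u _; case: ifP => _; by rewrite ?subr0 ?subrr.
Qed.

Lemma sum_first_visit n x : S x -> \sum_(0 <= k < n) first_visit k x = 1 - avoid n x.
Proof.
move=> Sx; elim: n => [|n IH]; first by rewrite big_geq// subrr.
by rewrite big_nat_recr//= IH first_visitE// addrA subrK.
Qed.

(** Reduces the extended-real recursion for passage times to iterates of the killed operator, which
    are real. *)
Lemma passage_atE n x : B `<=` S -> S x ->
  (passage_at K B n x = (first_visit n x)%:E)%E.
Proof.
move=> BS; elim: n x => [|n IH] x Sx /=.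
  transitivity (\esum_(y in B) (trans K x y * 1%:E))%E.
    by apply: eq_esum => y _; rewrite mule1.
  rewrite step_mean_esum_sub//; congr (_%:E); apply: eq_step_mean => // y _.
  by case: ifP.
transitivity (\esum_(y in S `\` B) (trans K x y * (first_visit n y)%:E))%E.
  by apply: eq_esum => y [Sy _]; rewrite IH.
rewrite step_mean_esum_sub//; last by move=> y []; move=> Sy _; exact: first_visit_ge0.
congr (_%:E); apply: eq_step_mean => // y Sy; rewrite in_setD.
by rewrite (mem_set Sy) andTb; case: (y \in B).
Qed.

(** The sum is the mean of the minimum of [n] and the passage time. Conditioning on the first step,
    the next sum is 1 plus [Q] of the present one, hence at most [1 + Q W <= W]. *)
Lemma sum_avoid_le W n x : S x -> (forall y, S y -> 0 <= W y) ->
  (forall y, S y -> Q W y <= W y - 1) -> \sum_(0 <= k < n) avoid k x <= W x.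
Proof.
move=> + W0 QW; elim: n x => [|n IH] x Sx; first by rewrite big_geq// W0.
rewrite big_nat_recl//= /avoid/=.
rewrite -[X in _ + X]/(\sum_(0 <= k < n) Q (avoid k) x) -killed_mean_sum.
rewrite addrC -lerBrDr; apply: le_trans (QW x Sx).
by apply: le_killed_mean.
Qed.

(** Summation by parts: the two sides differ by [n%:R * avoid n x]. *)
Lemma sum_passage_le n x : S x ->
  \sum_(0 <= k < n) k.+1%:R * first_visit k x <= \sum_(0 <= k < n) avoid k x.
Proof.
move=> Sx.
suff -> : \sum_(0 <= k < n) k.+1%:R * first_visit k x =
  \sum_(0 <= k < n) avoid k x - n%:R * avoid n x.
  by rewrite gerBl mulr_ge0// avoid_ge0.
elim: n => [|n IH]; first by rewrite !big_geq// mul0r subr0.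
rewrite !big_nat_recr//= IH first_visitE// -natr1 -avoidS; lra.
Qed.

(** The terms of a convergent series tend to 0, so the passage is almost sure; the same series
    dominates the mean passage time. *)
Lemma sum_avoid_passage_integrable x (M : R) : B `<=` S -> S x ->
  (forall n, \sum_(0 <= k < n) avoid k x <= M) -> passage_integrable K B x.
Proof.
move=> BS Sx avM.
have avoid0 : avoid ^~ x @ \oo --> (0 : R).
  apply: cvg_series_cvg_0.
  apply: nondecreasing_is_cvgn.
    by apply: nondecreasing_series => k _ _; exact: avoid_ge0.
  by exists M => _ [n _ <-]; exact: avM.
split.
  rewrite /passage_prob.
  under [X in limn X]eq_fun do (under eq_bigr do rewrite passage_atE//; rewrite sumEFin sum_first_visit//).
  apply/cvg_lim => //; apply: cvg_EFin; first by near=> n.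
  rewrite [X in X @ _ --> _](_ : _ = fun n => 1 - avoid n x)//.
  by rewrite -[X in _ --> X]subr0; apply: cvgB => //; exact: cvg_cst.
rewrite /passage_mean.
apply: (@le_lt_trans _ _ M%:E); last exact: ltry.
apply: lime_le.
  apply: is_cvg_nneseries => k _ _; rewrite passage_atE// mule_ge0// ?lee_fin// ?first_visit_ge0//.
near=> n.
under eq_bigr do rewrite passage_atE// -EFinM.
rewrite sumEFin lee_fin; apply: le_trans (avM n); exact: sum_passage_le.
Unshelve. all: by end_near. Qed.

End Killed.
End StepMean.

(** * Drift conditions *)

Section Drift.
Local Open Scope classical_set_scope.
Variables (R : realType) (T : countType) (K : chain R T).
Hypotheses (Kstoch : is_stochastic K) (Kfin : finite_rows K).
Local Notation S := (states K).
Local Notation P := (step_mean K).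
Implicit Types (B D : set T) (f g h u : T -> R).

Lemma step_mean_gt0 g x y : S x -> S y -> trans K x y != 0%E ->
  (forall z, S z -> 0 <= g z) -> 0 < g y -> 0 < P g x.
Proof.
move=> Sx Sy pxy g0 gy.
have yx : y \in fset_set (succ_states K x).
  by rewrite in_fset_set; [exact/mem_set|exact: Kfin].
rewrite /step_mean (bigD1_seq y) ?fset_uniq//=; apply: ltr_wpDr.
  rewrite big_seq_cond; apply: sumr_ge0 => z /andP[zx _].
  have Sz := in_succ Kfin Sx zx.
  by rewrite mulr_ge0 ?g0// trans_ge0.
rewrite mulr_gt0// lt_neqAle trans_ge0// andbT eq_sym.
by rewrite fine_eq0// (trans_fin Kstoch).
Qed.

Lemma exists_succ x : S x -> exists2 y, S y & trans K x y != 0%E.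
Proof.
move=> Sx; apply: contrapT => /forall2NP noy.
have := step_mean_cst Kstoch Kfin 1 Sx.
rewrite /step_mean (_ : succ_states K x = set0) ?fset_set0 ?big_nil; last first.
  by apply/seteqP; split => // y [Sy pxy]; case: (noy y).
by move/eqP; rewrite eq_sym oner_eq0.
Qed.

Section Foster.
Variable B : set T.
Local Notation Q := (killed_mean K B).
Local Notation avoid := (avoid K B).

(** The chain cannot be in [B] at time [n.+1] if it has avoided [B] up to then. *)
Lemma iter_indic_le n x : S x ->
  iter n.+1 P (fun y => (y \in B)%:R) x <= 1 - avoid n.+1 x.
Proof.
elim: n x => [|n IH] x Sx.
  by have := first_visitE Kstoch Kfin B 0 Sx; rewrite /first_visit/= => ->.
rewrite iterS; apply: le_trans (le_step_mean Kstoch Kfin Sx IH) _.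
rewrite step_meanB (step_mean_cst Kstoch Kfin)// lerD2l lerN2.
rewrite [leLHS]/(Q (avoid n.+1) x); apply: killed_mean_le => // y Sy.
exact: (avoid_ge0 Kstoch Kfin).
Qed.

Hypothesis accB : forall x, S x -> exists2 y, B y & accessible K x y.

Lemma avoid_lt1 x : S x -> exists n, avoid n x < 1.
Proof.
(* Accessibility may hold in zero steps, while [avoid] counts positive times only; hence one step is
   taken before the path to [B]. *)
move=> Sx; have [y Sy pxy] := exists_succ Sx.
have [b Bb [n nyb]] := accB Sy.
exists n.+1; rewrite -subr_gt0; apply: lt_le_trans (iter_indic_le n Sx).
have ind0 z : 0 <= (z \in B)%:R :> R by rewrite ler0n.
rewrite iterS; apply: (step_mean_gt0 Sx Sy pxy) => [z Sz|].
  exact: (iter_step_mean_ge0 Kstoch Kfin).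
rewrite (nstepE Kstoch Kfin)// lte_fin in nyb.
apply: lt_le_trans nyb _; apply: (le_iter_step_mean Kstoch Kfin) => // z _.
by have [->|_] := eqVneq z b; rewrite ?(mem_set Bb).
Qed.

(** The killed drift of [u] absorbs the increase of a Lyapunov function on a finite list. Each entry
    contributes a truncated mean passage time, divided by the probability of reaching [B] from that
    entry within the truncation time. *)
Lemma hitting_corrector (s : seq T) : (forall x, x \in s -> S x) ->
  exists2 u, (forall y, S y -> 0 <= u y) &
             forall y, S y -> Q u y <= u y - (y \in s)%:R.
Proof.
elim: s => [|x s IH] sS.
  exists (fun=> 0) => // y Sy; rewrite subr0 -[leRHS](step_mean_cst Kstoch Kfin 0 Sy).
  exact: (killed_mean_le Kstoch Kfin).
have [y ys|u u0 Qu] := IH; first by apply: sS; rewrite in_cons ys orbT.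
have Sx : S x by apply: sS; rewrite mem_head.
have [n /[dup] nx] := avoid_lt1 Sx; rewrite -subr_gt0 => dx.
set d := 1 - avoid n x in dx.
(* The sum is the mean of [min (tau_B, n)]; its drift under the killed chain is
   minus the probability of [tau_B <= n]. *)
exists (fun y => u y + d^-1 * \sum_(0 <= k < n) avoid k y) => y Sy.
  rewrite addr_ge0 ?u0// mulr_ge0//; first by rewrite invr_ge0 ltW.
  by apply: sumr_ge0 => k _; exact: (avoid_ge0 Kstoch Kfin).
rewrite killed_meanD killed_meanZ killed_mean_sum.
have -> : \sum_(0 <= k < n) Q (avoid k) y =
          \sum_(0 <= k < n) avoid k y - 1 + avoid n y.
  apply/eqP; rewrite -addrA -subr_eq opprD opprK addrC.
  have := sum_first_visit Kstoch Kfin B n Sy => /eqP.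
  under eq_bigr do rewrite (first_visitE Kstoch Kfin)//.
  by rewrite sumrB subr_eq -subr_eq0 => /eqP H; apply/eqP; move: H; rewrite /avoid/=; lra.
rewrite in_cons; have := Qu y Sy.
have a1 : avoid n y <= 1 by exact: (avoid_le1 Kstoch Kfin).
have [->|yx]/= := eqVneq y x.
  have : d^-1 * d = 1 by rewrite mulVf ?gt_eqF.
  rewrite {2}/d => dd; case: (x \in s) => /=; nra.
have : 0 <= d^-1 * (1 - avoid n y) by rewrite mulr_ge0 ?invr_ge0 ?subr_ge0// ltW.
nra.
Qed.

(** With the corrector [u] of [s], the function [V + c * u] decreases by 1 under the killed chain
    and so bounds the sums of [avoid]. The target [B] is chosen independently of [s], so the
    criterion serves single states and whole classes. *)
Lemma foster (V : T -> R) (s : seq T) (c : R) :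
    B `<=` S -> (forall x, x \in s -> S x) ->
    (forall x, S x -> 0 <= V x) -> 0 <= c ->
    (forall x, S x -> P V x <= V x - 1 + c * (x \in s)%:R) ->
  forall x, S x -> passage_integrable K B x.
Proof.
move=> BS sS V0 c0 PV x Sx; have [u u0 Qu] := hitting_corrector sS.
apply: (@sum_avoid_passage_integrable _ _ _ _ _ _ _ (V x + c * u x)) => // n.
apply: (@sum_avoid_le _ _ _ Kstoch Kfin B (fun x => V x + c * u x)) => // y Sy.
  by rewrite addr_ge0 ?V0// mulr_ge0// u0.
rewrite killed_meanD killed_meanZ.
have := killed_mean_le Kstoch Kfin B Sy V0.
have := PV _ Sy; have := ler_wpM2l c0 (Qu _ Sy); rewrite mulrBr; lra.
Qed.

(** Returns to [B] are dominated by geometric trials with ratio [r]. The bound on the return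
    probability is uniform over [B] because [B] will be a whole fibre of states. In the result, 1
    accounts for time 0 and [1 + r / (1 - r)] for the later visits. *)
Lemma green_bound (r : R) : 0 <= r < 1 ->
    (forall x n, S x -> B x -> \sum_(0 <= k < n) first_visit K B k x <= r) ->
  forall x n, S x ->
    \sum_(0 <= k < n) iter k P (fun y => (y \in B)%:R) x <= 2 + r / (1 - r).
Proof.
move=> /andP[r0 r1] fvr.
pose q n x := \sum_(0 <= k < n) first_visit K B k x.
pose v n x := \sum_(0 <= k < n) iter k.+1 P (fun y => (y \in B)%:R) x.
pose t := r / (1 - r).
(* [r] bounds the probability of a return to [B], so [t] bounds the mean number
   of returns. *)
have t1 : (1 + t) * r = t by rewrite /t; field; rewrite gt_eqF// subr_gt0.
have t0 : 0 <= t by rewrite divr_ge0// subr_ge0 ltW.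
(* Split according to the first step: once it lands in [B], at most [(1 + t) * r = t] further visits
   are expected. *)
have vq n x : S x -> v n x <= (1 + t) * q n x.
  elim: n x => [|n IH] x Sx; first by rewrite /v /q !big_geq// mulr0.
  rewrite /v /q !big_nat_recl//.
  rewrite [X in _ + X](_ : _ = P (v n) x); last by rewrite step_mean_sum.
  rewrite [X in _ * (_ + X)](_ : _ = Q (q n) x); last by rewrite killed_mean_sum.
  rewrite /first_visit/= -step_meanD mulrDr -step_meanZ -killed_meanZ -step_meanD.
  apply: (le_step_mean Kstoch Kfin) => // y Sy.
  have := IH _ Sy; rewrite -/(v n y) -/(q n y).
  case: ifPn => [/set_mem By|nBy]; last by rewrite mulr0 !add0r.
  move=> vy; rewrite addr0 mulr1 lerD2l; apply: le_trans vy _.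
  by rewrite -[leRHS]t1 ler_wpM2l ?addr_ge0// fvr.
move=> x [|n] Sx; first by rewrite big_geq// addr_ge0.
rewrite big_nat_recl//= -/(v n x).
have := vq n x Sx; rewrite -/t.
have := sum_first_visit Kstoch Kfin B n Sx; rewrite -/(q n x) => ->.
have := avoid_ge0 Kstoch Kfin B n Sx.
have : (x \in B)%:R <= 1 :> R by case: (x \in B).
nra.
Qed.

End Foster.

(** From each state, some time at most [M] gains 1. Restarting repeatedly at such times eventually
    outweighs the growth [c * M] of an incomplete last block. *)
Lemma uniform_drift f (c : R) (M : nat) : 0 <= c ->
    (forall x, S x -> P f x <= f x + c) ->
    (forall x, S x -> exists2 n, (0 < n <= M)%N & iter n P f x <= f x - 1) ->
  exists N, forall n x, (N <= n)%N -> S x -> iter n P f x <= f x - 1.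
Proof.
move=> c0 Pf drift.
(* A bound valid on a window of [M] times improves by 1 at the time that follows the window. *)
have restart n b x : (forall m y, (n - M <= m)%N -> (m < n)%N -> S y -> iter m P f y <= f y + b) ->
    (M <= n)%N -> S x -> iter n P f x <= f x + b - 1.
  move=> H Mn Sx; have [k /andP[k0 kM] kx] := drift _ Sx.
  have kn : (k <= n)%N by exact: leq_trans kM Mn.
  rewrite -(subnKC kn) iterD.
  apply: (@le_trans _ _ (iter k P (fun y => f y + b) x)).
    apply: (le_iter_step_mean Kstoch Kfin) => // y Sy.
    by apply: H => //; [rewrite leq_sub2l|rewrite ltn_subrL k0 (leq_trans k0 kn)].
  by rewrite (iter_step_meanDc Kstoch Kfin)//; move: kx; lra.
have base n x : S x -> iter n P f x <= f x + c * M%:R.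
  have [m] := ubnP n; elim: m n x => // m IH n x nm Sx.
  have [Mn|nM] := leqP M n.
    suff : iter n P f x <= f x + c * M%:R - 1 by lra.
    apply: restart => // k y _ kn Sy; apply: IH => //.
    exact: leq_trans kn _.
  apply: le_trans (iter_step_mean_growth Kstoch Kfin n Pf Sx) _; rewrite lerD2l ler_wpM2l// ler_nat ltnW//.
have blocks k n x : (k * M <= n)%N -> S x -> iter n P f x <= f x + (c * M%:R - k%:R).
  elim: k n x => [|k IH] n x kn Sx; first by rewrite subr0 base.
  have -> : f x + (c * M%:R - k.+1%:R) = f x + (c * M%:R - k%:R) - 1 by rewrite -natr1; lra.
  rewrite mulSn in kn.
  apply: restart => //; last exact: leq_trans (leq_addr _ _) kn.
  move=> m y nm _ Sy; apply: IH => //; apply: leq_trans nm.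
  by rewrite leq_subRL// (leq_trans (leq_addr _ _) kn).
(* This [k] exceeds [c * M%:R + 1], so a net decrease of 1 remains. *)
pose k := (Num.truncn (c * M%:R)).+2.
exists (k * M)%N => n x kn Sx; apply: le_trans (blocks k n x kn Sx) _.
rewrite lerD2l /k -natr1.
have := truncnS_gt (c * M%:R); lra.
Qed.

(** The chain is observed every [N] steps: a block started outside [D] gains 1, one started in [D]
    loses at most [c * N]. The expected number of the latter is at most [G], so the losses stay
    bounded while the gains accumulate. *)
Lemma occupation_drift f (D : set T) (c G : R) (N : nat) x : (0 < N)%N -> 0 <= c ->
    (forall y, S y -> P f y <= f y + c) ->
    (forall y, S y -> ~ D y -> iter N P f y <= f y - 1) ->
    S x -> (forall n, \sum_(0 <= k < n) iter k P (fun y => (y \in D)%:R) x <= G) ->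
  exists2 n, (0 < n)%N & iter n P f x <= f x - 1.
Proof.
move=> N0 c0 Pf driftD Sx GD.
pose b := c * N%:R + 1.
have b0 : 0 <= b by rewrite addr_ge0// mulr_ge0.
have ind0 k : 0 <= iter k P (fun y => (y \in D)%:R) x.
  exact: (iter_step_mean_ge0 Kstoch Kfin).
have H M : iter (M * N) P f x <=
    f x - M%:R + b * \sum_(0 <= k < M * N) iter k P (fun y => (y \in D)%:R) x.
  elim: M => [|M IH]; first by rewrite mul0n/= big_geq// mulr0 addr0 subr0.
  rewrite mulSn addnC iterD.
  apply: (@le_trans _ _ (iter (M * N) P (fun y => f y + (-1 + b * (y \in D)%:R)) x)).
    apply: (le_iter_step_mean Kstoch Kfin) => // y Sy.
    have [yD|yD] := boolP (y \in D); rewrite ?mulr1 ?mulr0.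
      by have := iter_step_mean_growth Kstoch Kfin N Pf Sy; rewrite /b; lra.
    by have := driftD _ Sy; rewrite notin_setE in yD => /(_ yD); lra.
  rewrite (iter_step_meanD Kfin)// (iter_step_meanD Kfin)//.
  rewrite (iter_step_mean_cst Kstoch Kfin)// (iter_step_meanZ Kfin)//.
  rewrite (@big_cat_nat _ _ _ (M * N))//= ?leq_addr//.
  (* Only the first time of the block is charged; the other occupation terms are nonnegative. *)
  rewrite [X in _ <= _ + b * (_ + X)]big_ltn; last by rewrite -[X in (X < _)%N]addn0 ltn_add2l.
  set s := (X in _ <= _ + b * (_ + (_ + X))).
  have s0 : 0 <= s by apply: sumr_ge0.
  have := mulr_ge0 b0 s0.
  move: IH; rewrite -natr1 !mulrDr. lra.
pose M := (Num.truncn (b * G)).+2.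
exists (M * N)%N; first by rewrite muln_gt0.
apply: le_trans (H M) _.
have := ler_wpM2l b0 (GD (M * N)%N).
have : b * G + 1 < M%:R by rewrite /M -natr1 ltrD2r; exact: truncnS_gt.
lra.
Qed.

(** In [n] steps [f] rises by at most [c * n%:R], so states with larger values do not enter the
    iterated mean. *)
Lemma le_iter_reach f (c : R) g h n x : S x ->
    (forall y z, S y -> S z -> trans K y z != 0%E -> f z <= f y + c) ->
    (forall y, S y -> f y <= f x + c * n%:R -> g y <= h y) ->
  iter n P g x <= iter n P h x.
Proof.
move=> + fstep; elim: n x => [|n IH] x Sx gh /=.
  by apply: gh => //; rewrite mulr0 addr0.
rewrite /step_mean big_seq [leRHS]big_seq; apply: ler_sum => y yx.
have Sy := in_succ Kfin Sx yx.
rewrite ler_wpM2l ?trans_ge0//; apply: IH => // z Sz fz; apply: gh => //.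
apply: le_trans fz _; move: yx; rewrite in_fset_set; last exact: Kfin.
move=> /set_mem[_ pxy]; have := fstep _ _ Sx Sy pxy; rewrite -natr1; lra.
Qed.

End Drift.

(** * Drift from almost sure convergence *)

Section Realization.
Local Open Scope classical_set_scope.
Variables (R : realType) (T : countType) (K : chain R T).
Hypotheses (Kstoch : is_stochastic K) (Kfin : finite_rows K).
Local Notation S := (states K).
Variables (disp : measure_display) (Omega : measurableType disp).
Variables (P : probability Omega R) (x0 : T) (Y : nat -> Omega -> T).
Hypotheses (Sx0 : S x0) (HY : is_realization P K x0 Y).

Let path_set n (y : nat -> T) := [set omega | forall k, (k <= n)%N -> Y k omega = y k].

Lemma measurable_realization n (D : set T) : measurable (Y n @^-1` D).
Proof.
have [mY _ _ _] := HY.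
rewrite (_ : _ @^-1` _ = \bigcup_y (if y \in D then Y n @^-1` [set y] else set0)).
  apply: countable_bigcupT_measurable => [|y]; first exact: countableP.
  by case: ifP => // _; exact: mY.
apply/seteqP; split => [w Dw|w [y _]].
  by exists (Y n w) => //; rewrite mem_set.
by case: ifPn => // /set_mem Dy /= ->.
Qed.

Lemma measurable_path_set n y : measurable (path_set n y).
Proof.
rewrite (_ : path_set n y = \bigcap_(k in [set k | (k <= n)%N]) (Y k @^-1` [set y k])).
  by apply: bigcap_measurable => [|k _]; [exists 0%N|exact: measurable_realization].
by apply/seteqP; split => w H k /H.
Qed.

(** Induction on [m], extending the prescribed path by one state; distinct extensions are disjoint
    events. An inequality suffices, since the law only serves to bound iterated means of indicators
    from above. *)
Lemma path_law m n y (D : set T) : (forall k, S (y k)) ->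
  (P (path_set n y) * (iter m (step_mean K) (fun z => (z \in D)%:R) (y n))%:E <=
   P (path_set n y `&` Y (n + m)%N @^-1` D))%E.
Proof.
have mI n' y' m' : measurable (path_set n' y' `&` Y m' @^-1` D).
  by apply: measurableI; [exact: measurable_path_set|exact: measurable_realization].
elim: m n y => [|m IH] n y Sy /=.
  have [yD|yD] := boolP (y n \in D); last by rewrite mule0.
  rewrite mule1 addn0 le_measure ?inE//; first exact: measurable_path_set.
  by move=> w Hw; split => //=; rewrite Hw//; exact/set_mem.
have [_ _ _ step] := HY.
(* Continuing the path by the constant [u] keeps all its values in the state space; only times up to
   [n.+1] matter. *)
pose ext u k := if (k <= n)%N then y k else u.
have Sext u : S u -> forall k, S (ext u k) by move=> Su k; rewrite /ext; case: ifP.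
have Pext u : S u -> P (path_set n.+1 (ext u)) = (P (path_set n y) * trans K (y n) u)%E.
  move=> Su; rewrite /path_set step ?Sext//; last exact: Sext.
  rewrite {2 3}/ext leqnn ltnn; congr (P _ * _)%E.
  by apply/seteqP; split => w H k kn; rewrite H// /ext kn.
have g0 u : S u -> 0 <= iter m (step_mean K) (fun z => (z \in D)%:R) u.
  by move=> Su; exact: (iter_step_mean_ge0 Kstoch Kfin).
have succS u : u \in fset_set (succ_states K (y n)) -> S u.
  by apply: in_succ => //; exact: Sy.
rewrite {1}/step_mean -sumEFin big_seq ge0_sume_distrr; last first.
  by move=> u /succS Su; rewrite lee_fin mulr_ge0 ?g0// trans_ge0.
apply: (@le_trans _ _ (\sum_(u <- fset_set (succ_states K (y n)))
    P (path_set n.+1 (ext u) `&` Y (n + m.+1)%N @^-1` D))%E).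
  rewrite [leRHS]big_seq; apply: lee_sum => u /succS Su.
  rewrite addnS -addSn; apply: le_trans (IH _ _ (Sext _ Su)).
  rewrite Pext// EFinM fineK ?(trans_fin Kstoch)// muleA.
  by rewrite /ext ltnn.
rewrite -measure_fbigsetU//; last first.
  apply/trivIsetP => u v _ _ uv; apply/seteqP; split => // w [[/(_ n.+1) Hu _] [/(_ n.+1) Hv _]].
  move: uv; apply/negP; rewrite negbK; apply/eqP.
  by have := Hu (leqnn _); have := Hv (leqnn _); rewrite /ext ltnn => -> ->.
apply: le_measure; rewrite ?inE//; first by apply: bigsetU_measurable => u _; exact: mI.
rewrite -bigcup_fset => w [u _ [Hw Dw]]; split => // k kn.
by rewrite Hw ?(leqW kn)// /ext kn.
Qed.

Lemma realization_law m (D : set T) :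
  ((iter m (step_mean K) (fun z => (z \in D)%:R) x0)%:E <= P (Y m @^-1` D))%E.
Proof.
have [_ _ Y0 _] := HY.
have := @path_law m 0%N (fun=> x0) D (fun=> Sx0).
rewrite (_ : path_set _ _ = setT) ?setTI ?probability_setT ?mul1e//.
by apply/seteqP; split => // w _ k; rewrite leqn0 => /eqP ->; exact: Y0.
Qed.

(** The events that [Y k] lies in [D k] for some [k >= n] decrease to a null set as [n] grows, so
    continuity from above applies. *)
Lemma realization_eventually (D : nat -> set T) :
    {ae P, forall omega, \forall n \near \oo, ~ D n (Y n omega)} ->
  (fun n => iter n (step_mean K) (fun z => (z \in D n)%:R) x0) @ \oo --> (0 : R).
Proof.
move=> aeD.
pose U n := \bigcup_(k in [set k | (n <= k)%N]) (Y k @^-1` D k).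
have mU n : measurable (U n).
  by apply: bigcup_measurable => k _; exact: measurable_realization.
have mcap : measurable (\bigcap_n U n) by apply: bigcapT_measurable.
have cap0 : P (\bigcap_n U n) = 0%E.
  apply: measure_negligible => //; apply: negligibleS aeD => w Uw /= [N _ HN].
  by have [k /= /HN] := Uw N I.
have : P \o U @ \oo --> P (\bigcap_n U n).
  apply: nonincreasing_cvg_mu => //.
    by apply: le_lt_trans (probability_le1 P _) (ltry _).
  move=> m n mn; apply/subsetPset => w [k /= nk Dk]; exists k => //=.
  exact: leq_trans nk.
rewrite cap0 => /fine_cvgP[_ Ucvg].
apply: (@squeeze_cvgr _ _ _ _ (fun=> 0) (fine \o (P \o U))); [|exact: cvg_cst|exact: Ucvg].
near=> n; apply/andP; split.
  exact: (iter_step_mean_ge0 Kstoch Kfin).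
rewrite -lee_fin /= fineK ?fin_num_measure//.
apply: le_trans (realization_law n (D n)) _.
apply: le_measure; rewrite ?inE//; first exact: measurable_realization.
by move=> w Dw; exists n => /=.
Unshelve. all: by end_near. Qed.

(** By almost sure convergence the slope exceeds [mu / 2] only with vanishing probability, and the
    bound on upward increments limits what this exceptional event adds to the mean. *)
Lemma realization_drift (f : T -> R) (c mu : R) :
    (forall y z, S y -> S z -> trans K y z != 0%E -> f z <= f y + c) ->
    mu < 0 ->
    {ae P, forall omega, (f (Y n omega) - f (Y 0%N omega)) / n%:R @[n --> \oo] --> mu} ->
  exists2 n, (0 < n)%N & iter n (step_mean K) f x0 <= f x0 - 1.
Proof.
move=> fstep mu0 aef; have [_ _ Y0 _] := HY.
pose D n := [set y | f x0 + mu / 2 * n%:R < f y].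
have p0 : (fun n => iter n (step_mean K) (fun z => (z \in D n)%:R) x0) @ \oo --> (0 : R).
  apply: realization_eventually; apply: filterS aef => w fw.
  have /(cvgr_lt _ fw) {}fw : mu < mu / 2 by lra.
  near=> n; rewrite /D/= => Df.
  have n0 : 0 < n%:R :> R by rewrite ltr0n; near: n; exact: nbhs_infty_gt.
  have : (f (Y n w) - f (Y 0%N w)) / n%:R < mu / 2 by near: n.
  rewrite ltr_pdivrMr// Y0; lra.
(* [b] dominates the excess of the worst slope [c] over [mu / 2]. *)
pose b : R := `|c - mu / 2| + 1.
have b0 : 0 < b by rewrite ltr_wpDl.
(* For this [n] the exceptional event costs at most [- mu / 4 * n], so the mean increment is at most
   [mu / 4 * n <= -1]. *)
have [n /andP[n0 nmu] pn] : exists2 n, (0 < n)%N && (4 / - mu <= n%:R) &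
    iter n (step_mean K) (fun z => (z \in D n)%:R) x0 < - mu / (4 * b).
  have e0 : 0 < - mu / (4 * b) by rewrite divr_gt0 ?mulr_gt0// oppr_gt0.
  near \oo => n; exists n; last by near: n; exact: (cvgr_lt _ p0 _ e0).
  apply/andP; split; first by near: n; exact: nbhs_infty_gt.
  by near: n; exact: nbhs_infty_ger.
exists n => //; set p := iter _ _ _ _ in pn.
have : iter n (step_mean K) f x0 <= f x0 + mu / 2 * n%:R + b * n%:R * p.
  rewrite /p -(iter_step_meanZ Kfin)// addrC -(iter_step_meanDc Kstoch Kfin)//.
  apply: (le_iter_reach Kstoch Kfin Sx0 fstep) => y Sy fy.
  have nn : 0 <= n%:R :> R by [].
  have [yD|yD] := boolP (y \in D n); rewrite ?mulr1 ?mulr0 ?add0r.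
    have : (c - mu / 2) * n%:R <= b * n%:R by rewrite ler_wpM2r// /b ler_wpDr// ler_norm.
    lra.
  by move: yD; rewrite notin_setE/= => /negP; rewrite -leNgt.
move/le_trans; apply.
have : b * p <= - mu / 4.
  rewrite mulrC -ler_pdivlMr//; apply/ltW; apply: lt_le_trans pn _.
  by rewrite invfM mulrA.
move=> /(ler_wpM2r (ler0n R n)).
have : 4 <= n%:R * - mu by rewrite -ler_pdivrMr// oppr_gt0.
lra.
Unshelve. all: by end_near. Qed.

End Realization.

(** * Expanded chains *)

Section Expanded.
Local Open Scope classical_set_scope.
Variables (R : realType) (d : nat) (L : mmrrw_data R d).
Implicit Types (A B : {set 'I_d}) (x t : 'rV[int]_d) (y z : state d).
Local Notation E A := (expanded_chain L A).

(** Makes the original chain the case of empty index, to which the lemmas on expanded chains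
    apply. *)
Lemma expanded_chain0 : E finset.set0 = mmrrw_chain L.
Proof.
rewrite /expanded_chain /mmrrw_chain; congr Chain.
  apply/seteqP; split => y /=; rewrite /face finset.set0U => -[y0 yn]; split => // l.
  by apply: y0; rewrite finset.in_set0.
by apply/funext => y; apply/funext => z; rewrite /face !finset.set0U.
Qed.

Definition max_modes := (\sum_(A : {set 'I_d}) nmodes L A)%N.

Lemma nmodes_le_max A : (nmodes L A <= max_modes)%N.
Proof. by rewrite /max_modes (bigD1 A)//= leq_addr. Qed.

Lemma finite_box x (N M : nat) :
  finite_set [set y : state d | (forall l, (0 <= y.1 ord0 l - x ord0 l <= N%:Z)%R) /\ (y.2 < M)%N].
Proof.
pose F (p : {ffun 'I_d -> 'I_N.+1} * 'I_M) : state d :=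
  (x + \row_l (p.1 l : nat)%:Z, p.2 : nat).
apply: (@sub_finite_set _ _ (F @` setT)); last exact/finite_image/finite_finset.
move=> [v j] /= [vN jM].
exists ([ffun l => inord `|v ord0 l - x ord0 l|%N], Ordinal jM) => //.
rewrite /F/=; congr pair; apply/rowP => l; rewrite !mxE ffunE.
have /andP[v0 vl] := vN l.
rewrite inordK; first by rewrite gez0_abs// addrC subrK.
by rewrite ltnS -lez_nat gez0_abs.
Qed.

Lemma face_sub A B x : A \subset B ->
    (forall l, l \in B -> l \notin A -> 0 < x ord0 l) -> face A x = face B x.
Proof.
move=> AB xAB; apply/setP => l; rewrite !inE.
have [lA|lA] := boolP (l \in A); first by rewrite (fintype.subsetP AB).
by have [lB|//] := boolP (l \in B); rewrite /= xAB.
Qed.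

Lemma states_sub A B y : A \subset B ->
    (forall l, l \in B -> l \notin A -> 0 < y.1 ord0 l) ->
  states (E A) y <-> states (E B) y.
Proof.
move=> AB yAB; rewrite /= (face_sub AB yAB); split => -[y0 yn]; split => // l lA.
  by apply: y0; apply: contra lA => /(fintype.subsetP AB).
have [lB|lB] := boolP (l \in B); last exact: y0.
exact/ltW/yAB.
Qed.

Lemma skip_free_coord x l : skip_free x -> -1 <= x ord0 l <= 1.
Proof. by move/forallP/(_ l); rewrite !inE => /or3P[] /eqP ->. Qed.

(** * Agreement of expanded chains away from the boundary *)

Section Locality.
Variables (A B : {set 'I_d}) (y : state d).
Hypotheses (AB : A \subset B) (yAB : forall l, l \in B -> l \notin A -> 1 < y.1 ord0 l).

Lemma skip_free_pos z : skip_free (z.1 - y.1) ->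
  forall l, l \in B -> l \notin A -> 0 < z.1 ord0 l.
Proof.
move=> /skip_free_coord zy l lB lA; have := yAB lB lA; have := zy l.
by rewrite !mxE => /andP[]; lra.
Qed.

(** A step lowers a coordinate by at most 1, so coordinates above 1 stay positive and both chains
    see the same face before and after the step. *)
Lemma trans_sub z : trans (E A) y z = trans (E B) y z.
Proof.
rewrite /=; case: ifPn => // /skip_free_pos zAB.
rewrite (face_sub AB zAB) (@face_sub A B y.1)// => l lB lA.
exact: lt_trans (yAB lB lA).
Qed.

Lemma states_succ_sub z : trans (E A) y z != 0%E -> states (E A) z <-> states (E B) z.
Proof.
rewrite /=; case: ifPn => [/skip_free_pos zAB _|_]; last by rewrite eqxx.
exact: states_sub.
Qed.

Lemma succ_states_sub : succ_states (E A) y = succ_states (E B) y.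
Proof.
have sub z := @trans_sub z.
apply/seteqP; split => z [Sz yz]; split.
- exact/(states_succ_sub yz).
- by rewrite -sub.
- by apply/(states_succ_sub _) => //; rewrite sub.
- by rewrite sub.
Qed.

Lemma step_mean_sub (g : state d -> R) : step_mean (E A) g y = step_mean (E B) g y.
Proof.
by rewrite /step_mean succ_states_sub; apply: eq_bigr => z _; rewrite trans_sub.
Qed.

End Locality.

(** * Translations along the coordinates in the index *)

Definition translate t y : state d := (y.1 + t, y.2).

Lemma translateK t : cancel (translate t) (translate (- t)).
Proof. by case=> v j; rewrite /translate/= addrK. Qed.

Lemma translateNK t : cancel (translate (- t)) (translate t).
Proof. by case=> v j; rewrite /translate/= subrK. Qed.

Section Translation.
Variables (A : {set 'I_d}) (t : 'rV[int]_d).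
Hypothesis tA : forall l, l \notin A -> t ord0 l = 0.

Lemma face_translate x : face A (x + t) = face A x.
Proof.
apply/setP => l; rewrite !inE; have [//|lA] := boolP (l \in A).
by rewrite !mxE tA// addr0.
Qed.

Lemma states_translate y : states (E A) (translate t y) <-> states (E A) y.
Proof.
rewrite /= face_translate; split => -[y0 yn]; split => // l lA.
  by have := y0 l lA; rewrite !mxE tA// addr0.
by rewrite !mxE tA// addr0; exact: y0.
Qed.

Lemma trans_translate y z : trans (E A) (translate t y) (translate t z) = trans (E A) y z.
Proof.
rewrite /= !face_translate (_ : z.1 + t - (y.1 + t) = z.1 - y.1)//.
by rewrite opprD addrACA subrr addr0.
Qed.

Lemma set_bij_translate (D D' : set (state d)) :
  (forall z, D' (translate t z) <-> D z) -> set_bij D D' (translate t).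
Proof.
move=> DD'; split.
- by move=> z Dz; apply/DD'.
- by move=> u v _ _ /(can_inj (@translateK t)).
- move=> z D'z; exists (translate (- t) z); last exact: translateNK.
  by apply/DD'; rewrite translateNK.
Qed.

Lemma set_bij_succ_states y :
  set_bij (succ_states (E A) y) (succ_states (E A) (translate t y)) (translate t).
Proof.
apply: set_bij_translate => z; rewrite /succ_states /mkset trans_translate.
by split => -[Sz yz]; split => //; apply/states_translate.
Qed.

End Translation.

Lemma finite_rows_expanded A : finite_rows (E A).
Proof.
move=> y Sy; apply: (sub_finite_set _ (finite_box (y.1 - const_mx 1) 2 max_modes)).
move=> z [[_ zn]]; rewrite /= (leq_trans zn (nmodes_le_max _)).
case: ifPn => [zy _|_ /eqP//]; split => // l.
have := skip_free_coord l zy; rewrite !mxE opprB addrCA [1 + _]addrC => /andP[a b].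
by rewrite -lerBlDr sub0r a (_ : 2%:Z = 1 + 1)// lerD2r b.
Qed.

Lemma forget_translate A y : y = translate (\row_l (if l \in A then y.1 ord0 l else 0)) (forget A y).
Proof.
case: y => v j; rewrite /translate/=; congr pair; apply/rowP => l; rewrite !mxE.
by case: ifP; rewrite ?add0r ?addr0.
Qed.

Lemma states_forget A y : states (E A) (forget A y) <-> states (E A) y.
Proof.
rewrite [in X in _ <-> X](forget_translate A y) states_translate// => l lA.
by rewrite mxE (negbTE lA).
Qed.

Lemma forget_id A y : forget A (forget A y) = forget A y.
Proof.
by rewrite /forget/=; congr pair; apply/rowP => l; rewrite !mxE; case: (l \in A).
Qed.

Lemma forgetK_translate A t y : (forall l, l \notin A -> t ord0 l = 0) ->
  forget A (translate t y) = forget A y.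
Proof.
move=> tA; rewrite /forget/=; congr pair; apply/rowP => l; rewrite !mxE; case: ifPn => // lA.
by rewrite tA// addr0.
Qed.

Hypothesis L_mmrrw : is_mmrrw L.

(** Stochasticity is assumed for the original chain. Translating the coordinates in [A] to the value
    2 preserves transition probabilities, and one step from there is a step of the original
    chain. *)
Lemma stochastic_expanded A : is_stochastic (E A).
Proof.
have [_ [p0 p1]] := L_mmrrw; rewrite -expanded_chain0 in p0 p1.
have up y : states (E A) y -> exists t, [/\ (forall l, l \notin A -> t ord0 l = 0),
    states (E finset.set0) (translate t y) &
    forall l, l \in A -> l \notin finset.set0 -> 1 < (translate t y).1 ord0 l].
  move=> Sy; pose t := \row_l (if l \in A then 2 - y.1 ord0 l else 0) : 'rV[int]_d.
  have tA l : l \notin A -> t ord0 l = 0 by move=> lA; rewrite mxE (negbTE lA).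
  have t2 l : l \in A -> l \notin finset.set0 -> 1 < (translate t y).1 ord0 l.
    by move=> lA _; rewrite !mxE lA; lra.
  exists t; split => //; apply/(states_sub (finset.sub0set A)); last exact/(states_translate tA).
  by move=> l lA l0; apply: lt_trans (t2 l lA l0).
split => y; last first.
  move=> Sy; have [t [tA S0 t1]] := up _ Sy.
  have succE K u : (\esum_(v in states K) trans K u v = \esum_(v in succ_states K u) trans K u v)%E.
    by apply: esum_succ_states.
  rewrite -(p1 _ S0) !succE (succ_states_sub (finset.sub0set A) t1).
  rewrite (reindex_esum _ _ _ _ (set_bij_succ_states tA y)).
  by apply: eq_esum => z _; rewrite (trans_sub (finset.sub0set A) t1) trans_translate.
move=> z Sy Sz; have [t [tA S0 t1]] := up _ Sy.
rewrite -(trans_translate tA) -(trans_sub (finset.sub0set A) t1).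
have [->//|nz] := eqVneq (trans (E finset.set0) (translate t y) (translate t z)) 0%E.
apply: p0 => //; apply/(states_succ_sub (finset.sub0set A) t1 nz).
exact/(states_translate tA).
Qed.

Local Notation P A := (step_mean (E A)).

Lemma step_mean_translate A t (g : state d -> R) y : (forall l, l \notin A -> t ord0 l = 0) ->
  states (E A) y -> P A g (translate t y) = P A (fun z => g (translate t z)) y.
Proof.
move=> tA Sy; rewrite /step_mean -!fsbig_finite; try exact: finite_rows_expanded.
- rewrite (reindex_fsbig (translate t) (succ_states (E A) y)).
    by apply: eq_fsbigr => z _; rewrite trans_translate.
  exact: set_bij_succ_states.
- by apply: finite_rows_expanded; apply/(states_translate tA).
Qed.

Lemma iter_step_mean_translate n A t (g : state d -> R) y :
  (forall l, l \notin A -> t ord0 l = 0) -> states (E A) y ->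
  iter n (P A) g (translate t y) = iter n (P A) (fun z => g (translate t z)) y.
Proof.
move=> tA; elim: n y => [//|n IH] y Sy /=; rewrite step_mean_translate//.
by apply: (eq_step_mean (@finite_rows_expanded A)) => // z Sz; rewrite IH.
Qed.

(* Before time [n] a coordinate that exceeds [n] does not reach 0, hence is
   not distinguished from a coordinate that the expanded chain lets be negative. *)
Lemma iter_step_mean_sub n A B (g : state d -> R) y : A \subset B -> states (E A) y ->
    (forall l, l \in B -> l \notin A -> n%:Z < y.1 ord0 l) ->
  iter n (P A) g y = iter n (P B) g y.
Proof.
move=> AB; elim: n y => [//|n IH] y Sy yn /=.
rewrite -(step_mean_sub AB); last first.
  by move=> l lB lA; apply: le_lt_trans (yn l lB lA).
rewrite /step_mean; rewrite big_seq [RHS]big_seq; apply: eq_bigr => z yz.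
have fr := @finite_rows_expanded A.
rewrite IH//; first exact: (in_succ fr Sy).
move: yz; rewrite in_fset_set; last exact: fr.
move=> /set_mem[_]; rewrite /=; case: ifPn => [zy _|_ /eqP//] l lB lA.
have := skip_free_coord l zy; have := yn l lB lA; rewrite intS !mxE => y1 /andP[zy1 _].
rewrite -subr_gt0; apply: lt_le_trans (_ : 0 < y.1 ord0 l - (1 + n%:Z)) _; first by rewrite subr_gt0.
by rewrite -subr_ge0 (_ : _ - _ = z.1 ord0 l - y.1 ord0 l - -1) ?subr_ge0//; ring.

Qed.

End Expanded.

(** * Induced chains *)

Lemma passage_atS (R : realType) (T : countType) (K : chain R T) B n x :
  passage_at K B n.+1 x =
  (\esum_(y in (states K `\` B)%classic) (trans K x y * passage_at K B n y))%E.
Proof. by []. Qed.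

Lemma esum_fibres (R : realType) (T U : choiceType) (D : set T) (I : set U)
    (phi : T -> U) (a : T -> \bar R) :
    (forall x, D x -> I (phi x) -> (0 <= a x)%E) ->
  (\esum_(x in (D `&` phi @^-1` I)%classic) a x =
   \esum_(v in I) \esum_(x in (D `&` phi @^-1` [set v])%classic) a x)%E.
Proof.
move=> a0; rewrite (esum_esum (a := fun=> a)); last first.
  by move=> v x Iv [Dx xv]; apply: a0 => //; rewrite xv.
apply: reindex_esum; split.
- by move=> [v x] /= [Iv [Dx xv]]; split => //=; rewrite xv.
- move=> [v x] [v' x'] /set_mem[/= _ [_ xv]] /set_mem[/= _ [_ xv']] xx'.
  by rewrite -xv -xv' xx'.
- by move=> x [Dx Ix]; exists (phi x, x).
Qed.

Section Induced.
Local Open Scope classical_set_scope.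
Variables (R : realType) (d : nat) (L : mmrrw_data R d).
Hypothesis L_mmrrw : is_mmrrw L.
Implicit Types (A B : {set 'I_d}) (y z : state d).
Local Notation E A := (expanded_chain L A).
Local Notation P A := (step_mean (E A)).

Let Est A : is_stochastic (E A) := stochastic_expanded L_mmrrw A.
Let Efr A : finite_rows (E A) := @finite_rows_expanded R d L A.

Definition fibre A z : set (state d) := states (E A) `&` forget A @^-1` [set z].

(** The induced chain is defined through the representative whose coordinates in [A] vanish;
    translation invariance gives the same sum at every point of its fibre. *)
Lemma trans_induced A y z : states (E A) y ->
  (trans (induced_chain L A) (forget A y) z = \esum_(u in fibre A z) trans (E A) y u)%E.
Proof.
move=> Sy; rewrite {1}/trans /induced_chain -/(fibre A z).
pose t := \row_l (if l \in A then y.1 ord0 l else 0) : 'rV[int]_d.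
have tA l : l \notin A -> t ord0 l = 0 by move=> lA; rewrite mxE (negbTE lA).
have fib (u : state d) : fibre A z (translate t u) <-> fibre A z u.
  by rewrite /fibre /setI /mkset /preimage /mkset forgetK_translate// states_translate.
rewrite [in RHS](forget_translate A y) -/t [RHS](reindex_esum _ _ _ _ (set_bij_translate fib)).
by apply: eq_esum => u _; rewrite trans_translate.
Qed.

(** Lumpability for passage times: the remaining passage probability is constant on each fibre, so
    it factors out of the sum over that fibre. *)
Lemma passage_at_induced A z n y : states (induced_chain L A) z -> states (E A) y ->
  (passage_at (induced_chain L A) [set z] n (forget A y) =
   (first_visit (E A) (fibre A z) n y)%:E)%E.
Proof.
move=> Sz; have fibS v : fibre A v `<=` states (E A) by move=> u [].
have mean v u c : states (E A) u -> 0 <= c ->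
    (\esum_(v' in fibre A v) (trans (E A) u v' * c%:E) =
     (\esum_(v' in fibre A v) trans (E A) u v') * c%:E)%E.
  move=> Su c0.
  have mc (b : R) : 0 <= b -> (\esum_(v' in fibre A v) (trans (E A) u v' * b%:E) =
      (P A (fun y => (y \in fibre A v)%:R) u * b)%:E)%E.
    move=> b0; rewrite (step_mean_esum_sub (Est A) (@Efr A) (g := fun=> b))//.
    rewrite mulrC -step_meanZ; congr ((P A _ u)%:E); apply/funext => v'.
    by case: (v' \in _); rewrite ?mulr1 ?mulr0.
  rewrite mc//; under [X in _ = (X * _)%E]eq_esum do rewrite -[trans _ _ _]mule1.
  by rewrite mc// mulr1.
elim: n y => [|n IH] y Sy.
  rewrite -(passage_atE (Est A) (@Efr A))// [LHS]/passage_at.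
  rewrite esum_set1 trans_induced//.
  by apply: esum_ge0 => u [Su _]; exact: (Est A).1.
rewrite -(passage_atE (Est A) (@Efr A))// !passage_atS.
rewrite (_ : states (E A) `\` fibre A z =
    states (E A) `&` forget A @^-1` (states (induced_chain L A) `\ z)); last first.
  apply/seteqP; split => u [Su].
    by move=> nu; split => //; split => [|uz]; [exists u|apply: nu].
  by move=> [_ uz]; split => // -[].
rewrite esum_fibres; last first.
  move=> u Su _; rewrite (passage_atE (Est A) (@Efr A))//.
  by rewrite mule_ge0 ?lee_fin ?(first_visit_ge0 (Est A) (@Efr A))// (Est A).1.
apply: eq_esum => v [[u Su <-] _].
rewrite IH// trans_induced// -mean ?(first_visit_ge0 (Est A) (@Efr A))//.
apply: eq_esum => u' [Su' /= uu'].
by rewrite -IH// -uu' IH// (passage_atE (Est A) (@Efr A))//.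
Qed.

(** The expanded chain returns to the fibre over [z] with the same probability from each of its
    points, namely the return probability of [z] in the induced chain. This is below 1, so
    [green_bound] applies; the bounds add up over [s]. *)
Lemma transient_visits A (s : seq (state d)) : transient (induced_chain L A) ->
    (forall z, z \in s -> states (induced_chain L A) z) ->
  exists G : R, forall y n, states (E A) y ->
    \sum_(0 <= k < n) iter k (P A) (fun u => (u \in [set u | forget A u \in s])%:R) y <= G.
Proof.
move=> tr sS.
have /choice[G HG] (z : state d) : exists G : R, z \in s -> forall y n, states (E A) y ->
    \sum_(0 <= k < n) iter k (P A) (fun u => (u \in fibre A z)%:R) y <= G.
  have [zs|] := boolP (z \in s); last by exists 0.
  have Sz := sS _ zs; have := tr _ Sz; set r := passage_prob _ _ _ => r1.
  have p0 y n : states (E A) y -> (0 <= passage_at (induced_chain L A) [set z] n (forget A y))%E.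
    by move=> Sy; rewrite passage_at_induced// lee_fin (first_visit_ge0 (Est A) (@Efr A)).
  have [u Su uz] := Sz.
  have pz n : (0 <= passage_at (induced_chain L A) [set z] n z)%E.
    by have := p0 u n Su; rewrite uz.
  have r0 : (0 <= r)%E by apply: nneseries_ge0 => n _ _; exact: pz.
  have rfin : r \is a fin_num by rewrite ge0_fin_numE// (lt_trans r1)// ltry.
  exists (2 + fine r / (1 - fine r)) => _ y n Sy.
  apply: (green_bound (Est A) (@Efr A)) => //.
    by rewrite fine_ge0// -lte_fin fineK.
  move=> x m Sx [_ /= xz]; rewrite -lee_fin fineK// -sumEFin.
  under eq_bigr do rewrite -(passage_at_induced _ Sz)// xz.
  by apply: nneseries_lim_ge => k _ _; exact: pz.
exists (\sum_(z <- s) G z) => y n Sy.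
apply: (@le_trans _ _ (\sum_(0 <= k < n) \sum_(z <- s)
    iter k (P A) (fun u => (u \in fibre A z)%:R) y)).
  apply: ler_sum => k _; rewrite -(iter_step_mean_sum (@Efr A))//.
  apply: (le_iter_step_mean (Est A) (@Efr A)) => // u Su.
  have [/set_mem /= us|_] := boolP (u \in _); last by apply: sumr_ge0.
  rewrite (big_rem _ us)/= ler_wpDr ?sumr_ge0// mem_set//.
rewrite exchange_big/= big_seq [leRHS]big_seq; apply: ler_sum => z zs.
exact: HG.
Qed.

End Induced.

(** * Drift of a linear function *)

Section LinearDrift.
Local Open Scope classical_set_scope.
Variables (R : realType) (d : nat) (L : mmrrw_data R d) (w : 'rV[R]_d).
Hypotheses (L_mmrrw : is_mmrrw L) (w_gt0 : forall l, 0 < w ord0 l).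
Implicit Types (A B : {set 'I_d}) (y z : state d).
Local Notation E A := (expanded_chain L A).
Local Notation P A := (step_mean (E A)).

Let Est A : is_stochastic (E A) := stochastic_expanded L_mmrrw A.
Let Efr A : finite_rows (E A) := @finite_rows_expanded R d L A.

Definition level y : R := \sum_l (y.1 ord0 l)%:~R * w ord0 l.

Definition weight : R := \sum_l w ord0 l.

Lemma weight_ge0 : 0 <= weight.
Proof. by apply: sumr_ge0 => l _; exact: ltW. Qed.

Lemma level_translate t y : level (translate t y) = level y + level (t, 0%N).
Proof.
by rewrite -big_split; apply: eq_bigr => l _; rewrite /= mxE intrD mulrDl.
Qed.

Lemma level_trans A y z : trans (E A) y z != 0%E -> level z <= level y + weight.
Proof.
rewrite /=; case: ifPn => [zy _|_ /eqP//].
rewrite -lerBlDl -sumrB; apply: ler_sum => l _.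
rewrite -mulrBl -intrB -[leRHS]mul1r ler_wpM2r ?(ltW (w_gt0 l))// lerz1.
by have := skip_free_coord l zy; rewrite !mxE => /andP[].
Qed.

Lemma step_mean_level A y : states (E A) y -> P A level y <= level y + weight.
Proof.
move=> Sy; rewrite -[leRHS](iter_step_mean_cst (Est A) (@Efr A) 1 _ Sy).
apply: (@le_iter_reach _ _ _ (Est A) (@Efr A) level weight _ _ 1) => //.
  by move=> u v _ _; exact: level_trans.
by move=> u _; rewrite mulr1.
Qed.

(** [level] is additive, so a translation shifts both terms alike. This reduces drift estimates in a
    box to finitely many states. *)
Lemma iter_step_mean_level_forget n A y : states (E A) y ->
  iter n (P A) level y - level y = iter n (P A) level (forget A y) - level (forget A y).
Proof.
move=> Sy; rewrite (forget_translate A y).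
set t := \row_l _; have tA l : l \notin A -> t ord0 l = 0 by move=> lA; rewrite mxE (negbTE lA).
have Sf : states (E A) (forget A y) by exact/states_forget.
rewrite forgetK_translate// forget_id iter_step_mean_translate//.
rewrite [in LHS]level_translate (eq_iter_step_mean (@Efr A) n Sf (fun u _ => level_translate t u)).
by rewrite (iter_step_meanDc (Est A) (@Efr A))//; lra.
Qed.

Lemma stable_drift A y : D_stable L A -> inner (mean_drift L A) w < 0 ->
  states (E A) y -> exists2 n, (0 < n)%N & iter n (P A) level y <= level y - 1.
Proof.
move=> stA neg Sy.
have drift : is_mean_drift L A (mean_drift L A).
  apply: contrapT => nodrift; move: neg; rewrite {1}/mean_drift xgetPN.
    by rewrite /inner big1 ?ltxx// => l _; rewrite mxE mul0r.
  by move=> v dv; apply: nodrift; exact: xgetI dv.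
case: (drift y Sy) => disp [space [Pr [Y [HY aeY]]]].
apply: (realization_drift (Est A) (@Efr A) Sy HY (c := weight) _ neg).
  by move=> u v _ _; exact: level_trans.
apply: filterS aeY => t Yt.
(* By linearity, the slope of [level] is the inner product of the coordinate slopes with [w]. *)
rewrite (_ : (fun n => _) = fun n => \sum_l
    (((Y n t).1 ord0 l - (Y 0%N t).1 ord0 l)%:~R / n%:R * w ord0 l)); last first.
  apply/funext => n; rewrite -sumrB mulr_suml; apply: eq_bigr => l _.
  by rewrite -mulrBl -intrB mulrAC.
by apply: cvg_big => [|l _]; [exact: add_continuous|apply: cvgMr_tmp; exact: Yt].
Qed.

(** All coordinates above [N] join the index at once; the resulting [B] strictly contains [A], and
    [N] steps from [y] have the same means in both chains. *)
Lemma outer_drift A N y :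
    (forall B, A \proper B -> forall z, states (E B) z ->
       iter N (P B) level z <= level z - 1) ->
    states (E A) y -> (exists2 l, l \notin A & N%:Z < y.1 ord0 l) ->
  iter N (P A) level y <= level y - 1.
Proof.
move=> HN Sy [l lA ly].
pose B : {set 'I_d} := (A :|: [set l | N%:Z < y.1 ord0 l])%SET.
have AB : A \subset B by exact: finset.subsetUl.
have yB l' : l' \in B -> l' \notin A -> N%:Z < y.1 ord0 l'.
  by rewrite !inE => /orP[->|].
rewrite (iter_step_mean_sub _ AB)//; apply: HN.
  by rewrite fintype.properE AB; apply/fintype.subsetPn; exists l => //; rewrite !inE ly orbT.
apply/(@states_sub _ _ L _ _ _ AB) => // l' lB l'A; exact: le_lt_trans (yB _ lB l'A).
Qed.

Definition box A N : set (state d) :=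
  [set y | states (E A) y /\ forall l, l \notin A -> y.1 ord0 l <= N%:Z].

Lemma finite_forget_box A N : finite_set (forget A @` box A N).
Proof.
apply: (sub_finite_set _ (finite_box 0 N (max_modes L))) => _ [y [[y0 yn] yN] <-] /=.
rewrite (leq_trans yn (nmodes_le_max _ _)); split => // l.
rewrite !mxE subr0; case: ifPn => // lA.
by rewrite y0// yN.
Qed.

Lemma not_box A N y : states (E A) y -> ~ box A N y ->
  exists2 l, l \notin A & N%:Z < y.1 ord0 l.
Proof.
move=> Sy; apply: contra_notP => /forall2NP H; split => // l lA.
by have [//|/negP] := H l; rewrite -leNgt.
Qed.

(** Outside the box, time [N] works. Inside, the time can be chosen as a function of the image under
    [forget A]; there are finitely many images, so the times are bounded and [uniform_drift]
    applies. *)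
Lemma box_drift A N : (0 < N)%N ->
    (forall B, A \proper B -> forall z, states (E B) z ->
       iter N (P B) level z <= level z - 1) ->
    (forall y, box A N y -> exists2 n, (0 < n)%N & iter n (P A) level y <= level y - 1) ->
  exists M, forall n y, (M <= n)%N -> states (E A) y -> iter n (P A) level y <= level y - 1.
Proof.
move=> N0 HN Hbox.
have /choice[m Hm] (z : state d) : exists n, z \in forget A @` box A N ->
    (0 < n)%N /\ iter n (P A) level z <= level z - 1.
  have [/set_mem [y yb <-]|_] := boolP (z \in _); last by exists 0%N.
  have [n n0 yn] := Hbox _ yb; exists n => _; split => //.
  have := iter_step_mean_level_forget n yb.1; lra.
(* The sum serves as a common upper bound for the chosen times. *)
pose M := (N + \sum_(z <- fset_set (forget A @` box A N)) m z)%N.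
apply: (uniform_drift (Est A) (@Efr A) (M := M) weight_ge0).
  by move=> y; exact: step_mean_level.
move=> y Sy; have [yb|/(not_box Sy) yb] := pselect (box A N y); last first.
  by exists N; [rewrite N0 leq_addr|exact: outer_drift].
have fy : forget A y \in forget A @` box A N by apply/mem_set; exists y.
have [m0 mle] := Hm _ fy; exists (m (forget A y)).
  rewrite m0 /M (big_rem (forget A y))/=; first by rewrite addnCA leq_addr.
  by rewrite in_fset_set//; exact: finite_forget_box.
have := iter_step_mean_level_forget (m (forget A y)) Sy; lra.
Qed.

(** The box is the exceptional set of [occupation_drift]: transience bounds the expected time spent
    in its finitely many fibres. *)
Lemma transient_box_drift A N y : transient (induced_chain L A) -> (0 < N)%N ->
    (forall B, A \proper B -> forall z, states (E B) z ->
       iter N (P B) level z <= level z - 1) ->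
    states (E A) y ->
  exists2 n, (0 < n)%N & iter n (P A) level y <= level y - 1.
Proof.
move=> tr N0 HN Sy; pose s := fset_set (forget A @` box A N).
have sE z : (z \in s) = (z \in forget A @` box A N).
  by rewrite in_fset_set//; exact: finite_forget_box.
have [z|G HG] := @transient_visits _ _ _ L_mmrrw A s tr.
  by rewrite sE => /set_mem[u [Su _] <-]; exists u.
apply: (@occupation_drift _ _ _ (Est A) (@Efr A) level [set u | forget A u \in s]
   weight G N) => //; first exact: weight_ge0.
- by move=> z; exact: step_mean_level.
- move=> z Sz zs; apply: outer_drift => //; apply: not_box => // zb; apply: zs.
  by rewrite /= sE; apply/mem_set; exists z.
- by move=> n; exact: HG.
Qed.

Hypothesis L_induced : forall A : {set 'I_d}, A != finset.set0 ->
  (semi_irreducible (induced_chain L A) /\ stable (induced_chain L A)) \/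
  transient (induced_chain L A).
Hypothesis w_drift : forall A, D_stable L A -> inner (mean_drift L A) w < 0.

Lemma common_time A :
    (forall B, A \proper B -> exists M, forall n y, (M <= n)%N -> states (E B) y ->
       iter n (P B) level y <= level y - 1) ->
  exists2 N, (0 < N)%N & forall B, A \proper B -> forall z, states (E B) z ->
       iter N (P B) level z <= level z - 1.
Proof.
move=> H; have /choice[M HM] B : exists M, A \proper B -> forall n y, (M <= n)%N ->
    states (E B) y -> iter n (P B) level y <= level y - 1.
  have [/H[M HM]|_] := boolP (A \proper B); first by exists M.
  by exists 0%N.
exists (\sum_B M B).+1%N => // B AB z Sz; apply: HM => //.
by rewrite (bigD1 B)//= leqW// leq_addr.
Qed.

(** Induction on the number of coordinates outside [A]. When there are none, no larger index exists
    and the box is the whole state space. *)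
Lemma uniform_level_drift A : A != finset.set0 ->
  exists M, forall n y, (M <= n)%N -> states (E A) y -> iter n (P A) level y <= level y - 1.
Proof.
have [k] := ubnP #|~: A|; elim: k A => // k IH A Ak A0.
have [N N0 HN] : exists2 N, (0 < N)%N & forall B, A \proper B -> forall z, states (E B) z ->
       iter N (P B) level z <= level z - 1.
  apply: common_time => B AB; apply: IH; last first.
    by apply: contraTneq AB => ->; rewrite fintype.properE finset.subset0 negb_and A0.
  move: Ak; rewrite ltnS; apply: leq_trans; apply: proper_card.
  by rewrite fintype.properE !finset.setCS -fintype.properE.
apply: (box_drift N0 HN) => y [Sy _].
have [[si st]|tr] := L_induced A0; last exact: transient_box_drift tr N0 HN Sy.
by apply: stable_drift => //; apply: w_drift.
Qed.

Lemma passage_integrable_mmrrw (C : set (state d)) :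
    C `<=` states (mmrrw_chain L) ->
    (forall y, states (mmrrw_chain L) y -> exists2 z, C z & accessible (mmrrw_chain L) y z) ->
  forall y, states (mmrrw_chain L) y -> passage_integrable (mmrrw_chain L) C y.
Proof.
rewrite -expanded_chain0; set A := finset.set0 => CS acc.
have [N N0 HN] : exists2 N, (0 < N)%N & forall B, A \proper B -> forall z, states (E B) z ->
       iter N (P B) level z <= level z - 1.
  apply: common_time => B AB; apply: uniform_level_drift.
  by rewrite -finset.proper0.
(* With empty index nothing is forgotten, so the box itself is finite. *)
have forget0 (y : state d) : forget A y = y.
  case: y => v j; congr pair; apply/rowP => l; by rewrite mxE finset.in_set0.
have finb : finite_set (box A N).
  have := finite_forget_box A N.
  by rewrite (_ : _ @` _ = box A N)// (eq_image_id (fun y _ => forget0 y)).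
(* The one-step drift of this sum telescopes to the [N]-step drift of [level]. *)
pose V y := \sum_(0 <= k < N) iter k (P A) level y.
have level0 y : states (E A) y -> 0 <= level y.
  move=> [y0 _]; apply: sumr_ge0 => l _; apply: mulr_ge0; last exact: ltW.
  by rewrite ler0z y0// finset.in_set0.
have iter0 k y : states (E A) y -> 0 <= iter k (P A) level y.
  by move=> Sy; exact: (iter_step_mean_ge0 (Est A) (@Efr A)).
have PV y : P A V y = V y - level y + iter N (P A) level y.
  rewrite /V step_mean_sum -[X in X = _]/(\sum_(0 <= k < N) iter k.+1 (P A) level y).
  elim: N {N0 HN finb V} => [|n IH]; first by rewrite !big_geq//= sub0r addNr.
  by rewrite !big_nat_recr//= IH; lra.
(* In the box the mean of [level] may grow by [weight * N%:R] in [N] steps; the extra 1 offsets the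
   decrease required by [foster]. *)
have b0 : 0 <= weight * N%:R + 1 by rewrite addr_ge0// mulr_ge0 ?weight_ge0.
apply: (@foster _ _ _ (Est A) (@Efr A) C acc V (fset_set (box A N)) (weight * N%:R + 1)) => //.
- by move=> y; rewrite in_fset_set// => /set_mem[].
- by move=> y Sy; apply: sumr_ge0 => k _; exact: iter0.
- move=> y Sy; rewrite PV in_fset_set//.
  have [_|/negP ny] := boolP (y \in box A N); rewrite ?mulr1 ?mulr0.
    by have := iter_step_mean_growth (Est A) (@Efr A) N (@step_mean_level A) Sy; lra.
  have /(not_box Sy) yb : ~ box A N y by move=> yb; apply: ny; exact/mem_set.
  by have := outer_drift HN Sy yb; lra.
Qed.

End LinearDrift.

Theorem theorem3p1 (R : realType) (d : nat) (d_gt0 : (0 < d)%N)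
    (L : mmrrw_data R d) (L_mmrrw : is_mmrrw L)
    (L_semi_irreducible : semi_irreducible (mmrrw_chain L))
    (L_induced : forall A : {set 'I_d}, A != finset.set0 ->
       (semi_irreducible (induced_chain L A) /\ stable (induced_chain L A)) \/
       transient (induced_chain L A)) :
  (exists w : 'rV[R]_d,
     (forall l, 0 < w ord0 l) /\
     (forall A : {set 'I_d}, D_stable L A -> inner (mean_drift L A) w < 0)) ->
  stable (mmrrw_chain L).
Proof.
move=> [w [w_gt0 w_drift]]; have [C SC] := L_semi_irreducible.
have [[CS [c Cc] _ _] _ acc] := SC.
have integrable := passage_integrable_mmrrw L_mmrrw w_gt0 L_induced w_drift.
(* The target is [[set x]] for positive recurrence and [C] for passages from outside. *)
exists C; split => // [x Cx|x Sx _].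
  apply: integrable; [by move=> _ ->; exact: CS| |exact: CS].
  by move=> y Sy; exists x => //; exact: acc.
by apply: integrable => // y Sy; exists c => //; exact: acc.
Qed.
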